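(* Let $(Y,\|\cdot\|)$ be a normed space, and let $X$ be either $Y$ itself or the closed unit ball $\{x\in Y:\|x\|\leq 1\}$ of $Y$. Let $U=X\setminus\{0\}$, let $A=\{x\in Y:\|x\|=1\}$ be the unit sphere, and fix $t\in A$. Then the mapping $\Phi\colon X\to A$ given by $$\Phi(x)=\begin{cases}\dfrac{x}{\|x\|}, & x\in U,\\[1ex] t, & x\in X\setminus U,\end{cases}$$ is piecewise continuous. Hence the unit sphere $A$ is a piecewise continuous retract of the closed unit ball of $Y$, as well as of $Y$.
   Context: A map $f\colon X\to Z$ between Hausdorff topological spaces is piecewise continuous if there is an increasing sequence $(X_n)_{n\geq 0}$ (i.e. $X_n\subset X_{n+1}$) of nonempty closed subsets of $X$ such that $X=\bigcup_{n=0}^\infty X_n$ and the restriction $f|_{X_n}$ is continuous for each $n$. A subset $A\subset X$ is a piecewise continuous retract of $X$ if there is a piecewise continuous map $r\colon X\to A$ with $r(x)=x$ for every $x\in A$. *)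

(* Defs.v *)
From HB Require Import structures.
From mathcomp Require Import all_boot all_order all_algebra.
From mathcomp Require Import all_classical all_reals all_analysis.
Import Order.TTheory GRing.Theory Num.Theory.
Import numFieldNormedType.Exports.

Set Implicit Arguments.
Unset Strict Implicit.
Unset Printing Implicit Defensive.

Local Open Scope classical_set_scope.
Local Open Scope ring_scope.

(* [{within F n, continuous f}] is continuity of the restriction of [f] to
   [F n] for the subspace topology, not continuity of [f] at points of [F n]. *)
Definition piecewise_continuous (X Z : topologicalType) (f : X -> Z) : Prop :=
  [/\ hausdorff_space X, hausdorff_space Z &
    exists F : nat -> set X,
      [/\ forall n, F n `<=` F n.+1,
          forall n, F n !=set0 /\ closed (F n),
          \bigcup_n F n = setT
        & forall n, {within F n, continuous f}]].

(* The codomain of [r] is [A] coerced to the type [set_type A] of its elements,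
   which carries the topology induced by [X]. *)
Definition piecewise_continuous_retract (X : topologicalType) (A : set X)
  : Prop :=
  exists r : X -> A,
    piecewise_continuous r /\ forall a : A, r (set_val a) = a.

Definition unit_sphere (R : realType) (Y : normedModType R) : set Y :=
  [set x | `|x| = 1].

Definition unit_ball (R : realType) (Y : normedModType R) : set Y :=
  [set x | `|x| <= 1].

Arguments unit_sphere {R} Y.
Arguments unit_ball {R} Y.

Lemma Phi_subproof (R : realType) (Y : normedModType R) (t : unit_sphere Y)
    (x : Y) :
  (if x != 0 then `|x|^-1 *: x else set_val t) \in unit_sphere Y.
Proof.
case: ifPn => [x0|_]; last by apply/mem_set; exact: set_valP.
by rewrite inE /unit_sphere /= normrZ normfV normr_id mulVf // normr_eq0.
Qed.

Definition Phi (R : realType) (Y : normedModType R) (t : unit_sphere Y)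
    (x : Y) : unit_sphere Y :=
  exist _ (if x != 0 then `|x|^-1 *: x else set_val t) (Phi_subproof t x).

(* Main.v *)
(** The vector x / |x| depends continuously on x away from 0, so by pasting
    along the two closed parts Phi is continuous on each of the increasing
    closed sets {0} `|` {x : |x| >= 1/(n+1)}, and these exhaust the space.
    Piecewise continuity passes to the unit ball by precomposition with the
    inclusion, and to the sphere as codomain because a subset carries the
    initial topology of its inclusion. *)
Require Import Defs.
From HB Require Import structures.
From mathcomp Require Import all_boot all_order all_algebra.
From mathcomp Require Import all_classical all_reals all_analysis.
Import Order.TTheory GRing.Theory Num.Theory.
Import numFieldNormedType.Exports.

Local Open Scope classical_set_scope.
Local Open Scope ring_scope.

(** If [q] is a cluster point of the neighbourhoods of [p], continuity makes [f q] one for [f p];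
    these images then agree, and injectivity concludes. *)
Lemma continuous_inj_hausdorff (S T : topologicalType) (f : S -> T) :
  continuous f -> injective f -> hausdorff_space T -> hausdorff_space S.
Proof.
move=> cf injf hT p q pq; apply/injf/hT => A B /cf fA /cf fB.
by have [x [Ax Bx]] := pq _ _ fA fB; exists (f x).
Qed.

Lemma set_val_continuous (T : topologicalType) (A : set T) :
  continuous (set_val : A -> T).
Proof. exact: initial_continuous. Qed.

Lemma set_type_hausdorff (T : topologicalType) (A : set T) :
  hausdorff_space T -> hausdorff_space A.
Proof. exact: (continuous_inj_hausdorff _ _ _ (@set_val_continuous T A) val_inj). Qed.

Lemma piecewise_continuous_set_type (X T : topologicalType) (A : set T)
    (r : X -> A) :
  piecewise_continuous (set_val \o r) -> piecewise_continuous r.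
Proof.
move=> [hX hT [F [Finc Fcl Fcov Fcont]]].
split=> //; first exact: set_type_hausdorff.
exists F; split=> // n.
exact: (@continuous_comp_initial A (subspace (F n)) T set_val r (Fcont n)).
Qed.

(* The pieces must be nonempty: since they increase, it suffices to drop those
   that miss the image of a chosen point. *)
Lemma piecewise_continuous_comp (W X Z : topologicalType) (f : X -> Z)
    (g : W -> X) (w : W) :
  hausdorff_space W -> continuous g -> piecewise_continuous f ->
  piecewise_continuous (f \o g).
Proof.
move=> hW cg [hX hZ [F [Finc Fcl Fcov Fcont]]]; split=> //.
have [N _ FNw] : (\bigcup_n F n) (g w) by rewrite Fcov.
have Fmono m : F N `<=` F (m + N)%N.
  by elim: m => //= m IH; apply: subset_trans IH _; exact: Finc.
exists (fun n => g @^-1` F (n + N)%N); split.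
- by move=> n x; exact: Finc.
- move=> n; split; first by exists w; exact: Fmono.
  by apply: preimage_closed => [x _|]; [exact: cg|exact: (Fcl _).2].
- rewrite -subTset => x _.
  have [n _ Fnx] : (\bigcup_n F n) (g x) by rewrite Fcov.
  exists n => //=; elim: {+}N => [|m IH]; first by rewrite addn0.
  by rewrite addnS; exact: Finc.
- move=> n; apply/subspace_continuousP => x Fx U /=.
  by move=> /((subspace_continuousP _ _).1 (Fcont _) _ Fx) /cg.
Qed.

Lemma set_val_Phi (R : realType) (Y : normedModType R) (t : unit_sphere Y)
    (x : Y) :
  x != 0 -> set_val (Phi t x) = `|x|^-1 *: x.
Proof. by rewrite set_valE /= => ->. Qed.

(** Taking values in [Y] lets the same result serve for the sphere as a subset of [Y] and as a
    subset of the ball. *)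
Lemma piecewise_continuous_val_Phi (R : realType) (Y : normedModType R)
    (t : unit_sphere Y) :
  piecewise_continuous (set_val \o Phi t).
Proof.
split; [exact: norm_hausdorff..|].
pose G (n : nat) : set Y := [set x | n.+1%:R^-1 <= `|x|].
have G_closed n : closed (G n).
  apply: (@preimage_closed _ _ _ [set y : R | n.+1%:R^-1 <= y]); last exact: closed_ge.
  by move=> x _; exact: norm_continuous.
have zero_closed : closed [set 0 : Y].
  exact/accessible_closed_set1/hausdorff_accessible/norm_hausdorff.
exists (fun n => [set 0] `|` G n); split.
- move=> n x [->|Gx]; [by left|right; rewrite /G /=].
  by apply: le_trans Gx; rewrite lef_pV2 ?posrE ?ltr0n // ler_nat.
- by move=> n; split; [exists 0; left|exact: closedU].
- rewrite -subTset => x _; have [->|x0] := eqVneq x 0; first by exists 0%N => //; left.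
  have x_gt0 : 0 < `|x| by rewrite normr_gt0.
  (* For this [n], [|x|^-1 < n + 1]; inverting gives the bound that defines [G n]. *)
  exists (Num.truncn `|x|^-1) => //; right; rewrite /G /=.
  rewrite -[leRHS]invrK lef_pV2 ?posrE ?invr_gt0 ?ltr0n //.
  exact/ltW/truncnS_gt.
- move=> n; apply: withinU_continuous => //.
    by apply: continuous_subspace1.
  (* On [G n] the map agrees with normalization, which is continuous in the whole space at each
     point of [G n], the norm there being positive. *)
  apply: (@subspace_eq_continuous _ _ _ (fun x : Y => `|x|^-1 *: x)).
    move=> x; rewrite inE /G /= => Gx; apply/esym/set_val_Phi.
    by rewrite -normr_gt0 (lt_le_trans _ Gx) // invr_gt0 ltr0n.
  apply: continuous_in_subspaceT => x; rewrite inE /G /= => Gx.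
  apply: cvgZ; last exact: cvg_id.
  apply: cvgV; last exact: norm_continuous.
  by rewrite gt_eqF // (lt_le_trans _ Gx) // invr_gt0 ltr0n.
Qed.

Theorem theorem5 (R : realType) (Y : normedModType R) (t : unit_sphere Y) :
  [/\ piecewise_continuous (Phi t : Y -> unit_sphere Y),
      piecewise_continuous
        (fun x : unit_ball Y => Phi t (set_val x) : unit_sphere Y),
      piecewise_continuous_retract
        ([set x | unit_sphere Y (set_val x)] : set (unit_ball Y))
    & piecewise_continuous_retract (unit_sphere Y)].
Proof.
have Phi_id (x : Y) : `|x| = 1 -> set_val (Phi t x) = x.
  move=> x1; rewrite set_val_Phi; first by rewrite x1 invr1 scale1r.
  by rewrite -normr_eq0 x1 oner_eq0.
have Phi_pc : piecewise_continuous (Phi t : Y -> unit_sphere Y).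
  exact/piecewise_continuous_set_type/piecewise_continuous_val_Phi.
have ball_hausdorff : hausdorff_space (unit_ball Y).
  exact/set_type_hausdorff/norm_hausdorff.
have ball0 : (0 : Y) \in unit_ball Y by rewrite inE /unit_ball /= normr0.
have restr_pc (Z : topologicalType) (f : Y -> Z) :
    piecewise_continuous f -> piecewise_continuous (f \o @set_val Y (unit_ball Y)).
  (* The origin is the chosen point of the ball that keeps the pulled-back pieces nonempty. *)
  apply: piecewise_continuous_comp => //; first exact: (exist _ 0 ball0).
  exact: set_val_continuous.
have Phi_ball x : set_val (Phi t x) \in unit_ball Y.
  by rewrite inE /unit_ball /= (set_valP (Phi t x) : `|_| = 1).
pose A := [set x : unit_ball Y | unit_sphere Y (set_val x)].
pose Phi_b x : unit_ball Y := exist _ (set_val (Phi t x)) (Phi_ball x).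
have Phi_A x : Phi_b x \in A.
  by rewrite inE; exact: set_valP (Phi t x).
split=> //.
- exact: restr_pc.
- exists (fun x => exist _ (Phi_b (set_val x)) (Phi_A (set_val x))); split.
    (* Elements of [A] are nested: vectors of [Y], then points of the ball, then points of the
       sphere. Removing both layers leaves [set_val \o Phi t] on the ball. *)
    do 2!apply: piecewise_continuous_set_type.
    exact/(restr_pc _ (set_val \o Phi t))/piecewise_continuous_val_Phi.
  by move=> a; do 2!apply: val_inj; exact/Phi_id/(set_valP a).
- by exists (Phi t); split=> // a; apply/val_inj/Phi_id/(set_valP a).
Qed.
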